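(* The ambiguity set $$\mathcal P_\epsilon=\Big\{\mathbb Q\in\mathscr P(\Xi):\ \mathbb E_{z\sim\mathbb Z}\big[\big[\mathbb E_{\mathbb Q}[\ell(z,\xi)]-\mathbb E_{\hat{\mathbb P}_N}[\ell(z,\xi)]-\epsilon\big]_+\big]\le 0,\ \ \mathbb E_{\mathbb Q}[\|\xi\|^2]\le\Omega\Big\}$$ is equal to the infinitely constrained ambiguity set $$\Big\{\mathbb Q\in\mathscr P(\Xi):\ \mathbb E_{\mathbb Q}[\ell(z,\xi)]-\mathbb E_{\hat{\mathbb P}_N}[\ell(z,\xi)]\le\epsilon\ \ \forall z\in\mathcal X,\ \ \mathbb E_{\mathbb Q}[\|\xi\|^2]\le\Omega\Big\}.$$
   Context: The decision set $\mathcal X\subseteq\mathbb R^{D_x}$ is compact and convex, and $\Xi\subseteq\mathbb R^{D_\xi}$ is the support set of the random vector $\xi$; $\mathscr P(\Xi)$ is the set of probability distributions on $\Xi$. The loss is piecewise affine, $\ell(x,\xi)=\max_{j\in[J]}\big(a_j(x)^\top\xi+b_j(x)\big)$ with $a_j(x)=\mathbf A_jx+\bar{\mathbf a}_j$ and $b_j(x)=\mathbf b_j^\top x+\bar b_j$ affine in $x$, and $c_1,c_2\ge 0$ are constants with $|\ell(x,\xi)|\le c_1+c_2\|\xi\|$ for all $x\in\mathcal X$, $\xi\in\Xi$. $\mathbb P^\star\in\mathscr P(\Xi)$ is the true distribution and $\hat{\mathbb P}_N\in\mathscr P(\Xi)$ is a data-driven reference distribution. The constant $\Omega$ satisfies $\mathbb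 E_{\hat{\mathbb P}_N}[\|\xi\|^2]<\Omega$ and $\mathbb E_{\mathbb P^\star}[\|\xi\|^2]\le\Omega$. $\epsilon\ge 0$, and $\mathbb Z$ is a probability distribution with full support on $\mathcal X$. $[u]_+=\max\{u,0\}$ and $\|\cdot\|$ is the Euclidean norm. *)

(* Defs.v *)
From HB Require Import structures.
From mathcomp Require Import all_boot all_order all_algebra.
From mathcomp Require Import all_classical all_reals all_analysis.

Set Implicit Arguments.
Unset Strict Implicit.
Unset Printing Implicit Defensive.

Import Order.TTheory GRing.Theory Num.Theory.
Import numFieldNormedType.Exports.

Local Open Scope classical_set_scope.
Local Open Scope ring_scope.

(* R^n as column vectors with its Borel sigma-algebra; the library topology on
   matrices is the product topology, hence the Euclidean one. *)
Definition borelV (R : realType) (n : nat) :=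
  g_sigma_algebraType (@open 'cV[R]_n).

(* The norm `|x| of the library on matrices is the sup norm. *)
Definition enorm (R : realType) (n : nat) (x : 'cV[R]_n) : R :=
  Num.sqrt (\sum_(i < n) x i 0 ^+ 2).

(* Distributions on S are encoded as Borel probability measures on R^n that are
   concentrated on S. S need not be Borel: the condition says that S has full
   outer measure, so that these measures correspond to the probability measures
   on S with its trace sigma-algebra; see dist_onE for Borel S. *)
Definition dist_on (R : realType) (n : nat) (S : set 'cV[R]_n) :
    set (probability (borelV R n) R) :=
  [set P | forall A : set (borelV R n), measurable A -> S `<=` A -> P A = 1%E].

Lemma dist_onE (R : realType) (n : nat) (S : set 'cV[R]_n)
    (P : probability (borelV R n) R) :
  measurable (S : set (borelV R n)) -> dist_on S P <-> P S = 1%E.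
Proof.
move=> mS; split=> [|PS1 A mA SA]; first exact.
apply/eqP; rewrite eq_le probability_le1//= -PS1.
by apply: le_measure; rewrite ?inE.
Qed.

Definition dist_support (R : realType) (n : nat)
    (P : probability (borelV R n) R) : set 'cV[R]_n :=
  [set x | forall U : set 'cV[R]_n, open U -> U x -> (0 < P U)%E].

(* max_j (a_j(x)^T xi + b_j(x)) with a_j(x) = A_j x + abar_j and
   b_j(x) = b_j^T x + bbar_j. There are J.+1 pieces, so the maximum is over a
   nonempty set, and the default value of \big is one of its terms. *)
Definition pwa_piece (R : realType) (Dx Dxi J : nat)
    (A : 'I_J.+1 -> 'M[R]_(Dxi, Dx)) (abar : 'I_J.+1 -> 'cV[R]_Dxi)
    (b : 'I_J.+1 -> 'cV[R]_Dx) (bbar : 'I_J.+1 -> R)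
    (x : 'cV[R]_Dx) (xi : 'cV[R]_Dxi) (j : 'I_J.+1) : R :=
  ((A j *m x + abar j)^T *m xi) 0 0 + (((b j)^T *m x) 0 0 + bbar j).

Definition pwa_loss (R : realType) (Dx Dxi J : nat)
    (A : 'I_J.+1 -> 'M[R]_(Dxi, Dx)) (abar : 'I_J.+1 -> 'cV[R]_Dxi)
    (b : 'I_J.+1 -> 'cV[R]_Dx) (bbar : 'I_J.+1 -> R)
    (x : 'cV[R]_Dx) (xi : 'cV[R]_Dxi) : R :=
  \big[Num.max/pwa_piece A abar b bbar x xi ord0]_(j < J.+1)
    pwa_piece A abar b bbar x xi j.

(* In both sets below the moment constraint makes all expectations of the
   (linearly growing) loss finite, so no indeterminate difference occurs. *)
Definition ambiguity_set (R : realType) (Dx Dxi : nat) (Xi : set 'cV[R]_Dxi)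
    (ell : 'cV[R]_Dx -> 'cV[R]_Dxi -> R)
    (Z : probability (borelV R Dx) R) (PN : probability (borelV R Dxi) R)
    (eps Omega : R) : set (probability (borelV R Dxi) R) :=
  [set Q | [/\ dist_on Xi Q,
    (\int[Z]_z maxe ('E_Q[ell z] - 'E_PN[ell z] - eps%:E) 0 <= 0)%E &
    ('E_Q[fun xi => (enorm xi ^+ 2)%R] <= Omega%:E)%E]].

Definition inf_ambiguity_set (R : realType) (Dx Dxi : nat)
    (X : set 'cV[R]_Dx) (Xi : set 'cV[R]_Dxi)
    (ell : 'cV[R]_Dx -> 'cV[R]_Dxi -> R)
    (PN : probability (borelV R Dxi) R)
    (eps Omega : R) : set (probability (borelV R Dxi) R) :=
  [set Q | [/\ dist_on Xi Q,
    (forall z, X z -> ('E_Q[ell z] - 'E_PN[ell z] <= eps%:E)%E) &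
    ('E_Q[fun xi => (enorm xi ^+ 2)%R] <= Omega%:E)%E]].

(* Main.v *)
Require Import Defs.
From HB Require Import structures.
From mathcomp Require Import all_boot all_order all_algebra.
From mathcomp Require Import all_classical all_reals all_analysis.
From mathcomp Require Import measurable_realfun ring lra.
Import Order.TTheory GRing.Theory Num.Theory.
Import numFieldNormedType.Exports.
Local Open Scope classical_set_scope.
Local Open Scope ring_scope.

Set Implicit Arguments.
Unset Strict Implicit.

(** The expected excess loss of Q,
      g z = E_Q[ell z] - E_PN[ell z] - eps,
    is a finite, Lipschitz function of the decision z on the whole space.
    Indeed every affine piece, hence the maximum of the pieces, satisfies
      |ell z xi - ell z' xi| <= L |z - z'| w xi   with   w xi = 1 + |xi|^2,
    where |z - z'| is the sup norm and |xi| the Euclidean one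
    ([pwa_loss_lipschitz]) and grows at most like w xi ([pwa_loss_growth]),
    and w is integrable for every distribution with a finite second moment.
    Integrating the first bound makes g Lipschitz
    ([continuous_expected_pwa_loss]).

    The rest is about a continuous g and a distribution Z with support X
    ([integral_pos_part_le0P]).  If g <= 0 on X, then the closed set
    {g <= 0} has full measure, so that the positive part of g vanishes almost
    surely.  Conversely, if g z > 0 for some z in X, then g > g z / 2 on an
    open neighbourhood of z; it has positive measure because z is in the
    support, and it makes the integral of the positive part positive. *)

(** * Continuous functions and Borel probability measures on R^n *)

Lemma open_measurable_borelV (R : realType) (n : nat) (U : set 'cV[R]_n) :
  open U -> measurable (U : set (borelV R n)).
Proof. by move=> oU; exact: sub_sigma_algebra. Qed.

Lemma continuous_measurable_borelV (R : realType) (n : nat)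
    (f : 'cV[R]_n -> R) :
  continuous f -> measurable_fun [set: borelV R n] f.
Proof.
move=> /continuousP cf; apply: (measurability _ (RGenOpens.measurableE R)).
move=> _ [_ [a [b ->] <-]]; rewrite setTI.
by apply: open_measurable_borelV; apply: cf; exact: interval_open.
Qed.

Lemma lipschitz_continuous (R : realType) (V : normedModType R) (f : V -> R)
    (L : R) :
  (forall x y, `|f x - f y| <= L * `|x - y|) -> continuous f.
Proof.
move=> fL x; apply/cvgrPdist_le => e e0; near=> y.
apply: (le_trans (fL x y)).
have L0 : 0 < `|L| + 1 by rewrite ltr_wpDl.
apply: (@le_trans _ _ ((`|L| + 1) * `|x - y|)).
  by rewrite ler_wpM2r// (le_trans (ler_norm L))// lerDl.
rewrite mulrC -ler_pdivlMr//; near: y.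
by apply: (@cvgr_dist_le _ _ _ (nbhs x) _ id); [exact: cvg_id|exact: divr_gt0].
Unshelve. all: by end_near. Qed.

(** [dist_on] speaks only of measurable sets containing X, and X itself need not
    be measurable; the sublevel set of g is closed, hence such a set. *)
Lemma ae_dist_on_le (R : realType) (n : nat) (X : set 'cV[R]_n)
    (Z : probability (borelV R n) R) (g : 'cV[R]_n -> R) (t : R) :
  dist_on X Z -> continuous g -> (forall z, X z -> g z <= t) ->
  {ae Z, forall z, g z <= t}.
Proof.
move=> ZX cg gt.
have mC : measurable ([set z | g z <= t] : set (borelV R n)).
  rewrite -[X in measurable X]setCK; apply: measurableC.
  have -> : ~` [set z | g z <= t] = g @^-1` [set y | t < y].
    by apply/seteqP; split=> z /=; rewrite ltNge => /negP.
  apply: open_measurable_borelV.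
  by move/continuousP: cg; apply; exact: open_gt.
exists (~` [set z | g z <= t]); split => //; first exact: measurableC.
have := probability_setC Z mC.
by rewrite (ZX _ mC gt) subee.
Qed.

(** Continuity turns an inequality valid for almost every z into one valid at
    every point of the support: an open set where g stays above g z / 2 cannot
    be negligible if it contains a point of the support. *)
Lemma integral_pos_part_le0P (R : realType) (n : nat) (X : set 'cV[R]_n)
    (Z : probability (borelV R n) R) (g : 'cV[R]_n -> R) :
  dist_on X Z -> dist_support Z = X -> continuous g ->
  (\int[Z]_z (Num.max (g z) 0)%:E <= 0)%E <-> (forall z, X z -> g z <= 0).
Proof.
move=> ZX suppZ cg.
have mg : measurable_fun [set: borelV R n] g.
  exact: continuous_measurable_borelV.
have mh : measurable_fun [set: borelV R n] (fun z => (Num.max (g z) 0)%:E).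
  by apply/measurable_EFinP; exact: measurable_maxr.
have h0 (z : borelV R n) : (0 <= (Num.max (g z) 0)%:E)%E.
  by rewrite lee_fin le_max lexx orbT.
split=> [int0 z Xz|g0].
- rewrite leNgt; apply/negP => gz.
  pose U := g @^-1` [set y | g z / 2 < y].
  have oU : open U by move/continuousP: cg; apply; exact: open_gt.
  have Uz : U z by rewrite /U/=; lra.
  have mU := open_measurable_borelV oU.
  have ZU : (0 < Z U)%E by move: Xz; rewrite -suppZ; apply.
  suff : ((g z / 2)%:E * Z U <= 0)%E.
    by apply/negP; rewrite -ltNge mule_gt0// lte_fin; lra.
  apply: le_trans int0; rewrite -integral_cst//.
  apply: (@le_trans _ _ (\int[Z]_(y in U) (Num.max (g y) 0)%:E)%E).
    apply: ge0_le_integral => //.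
    - by move=> y _; rewrite lee_fin; lra.
    - exact: measurable_funS mh.
    - by move=> y Uy; rewrite lee_fin le_max/= (ltW Uy).
  by apply: ge0_subset_integral.
- have -> : (\int[Z]_z (Num.max (g z) 0)%:E = \int[Z]_z cst 0%E z)%E.
    apply: ge0_ae_eq_integral => //.
    have /= := ae_dist_on_le ZX cg g0.
    by apply: (@filterS _ _ (ae_filter_ringOfSetsType Z)) => z gz _;
      rewrite (max_idPr gz).
  by rewrite integral0.
Qed.

(** * Bounds on matrix products *)

Lemma norm_mx_le (R : realType) (m n : nat) (M : 'M[R]_(m, n)) (c : R) :
  0 <= c -> (forall i j, `|M i j| <= c) -> `|M| <= c.
Proof.
move=> c0 Mc; rewrite /Num.norm/= mx_normrE.
by apply: bigmax_le => // -[i j] _; exact: Mc.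
Qed.

Lemma norm_mx_entry_le (R : realType) (m n : nat) (M : 'M[R]_(m, n)) i j :
  `|M i j| <= `|M|.
Proof.
rewrite [leRHS]/Num.norm/= mx_normrE.
exact: (le_bigmax _ (fun ij : 'I_m * 'I_n => `|M ij.1 ij.2|) (i, j)).
Qed.

Lemma norm_trmx_le (R : realType) (m n : nat) (M : 'M[R]_(m, n)) :
  `|M^T| <= `|M|.
Proof. by apply: norm_mx_le => // i j; rewrite mxE norm_mx_entry_le. Qed.

Lemma norm_mulmx_le (R : realType) (m n p : nat) (M : 'M[R]_(m, n))
    (N : 'M[R]_(n, p)) : `|M *m N| <= n%:R * `|M| * `|N|.
Proof.
apply: norm_mx_le => [|i j]; first by rewrite !mulr_ge0.
rewrite mxE (le_trans (ler_norm_sum _ _ _))//.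
rewrite (@le_trans _ _ (\sum_(k < n) `|M| * `|N|))//.
  by apply: ler_sum => k _; rewrite normrM ler_pM// norm_mx_entry_le.
by rewrite sumr_const card_ord -[leLHS]mulr_natl mulrA.
Qed.

Lemma norm_dot_le (R : realType) (n : nat) (u v : 'cV[R]_n) :
  `|(u^T *m v) 0 0| <= n%:R * `|u| * `|v|.
Proof.
apply: le_trans (norm_mx_entry_le _ _ _) _.
apply: le_trans (norm_mulmx_le _ _) _.
by rewrite ler_wpM2r// ler_wpM2l// norm_trmx_le.
Qed.

(** * The weight 1 + |x|^2 *)

(** This weight dominates both the constants and the norm, so that it bounds
    every affine function of x up to a factor, while its integrability under a
    probability measure is exactly finiteness of the second moment. *)
Definition moment_weight (R : realType) (n : nat) (x : 'cV[R]_n) : R :=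
  1 + enorm x ^+ 2.

Lemma moment_weight_ge1 (R : realType) (n : nat) (x : 'cV[R]_n) :
  1 <= moment_weight x.
Proof. by rewrite lerDl sqr_ge0. Qed.

Lemma enorm_sqrE (R : realType) (n : nat) (x : 'cV[R]_n) :
  enorm x ^+ 2 = \sum_(i < n) x i 0 ^+ 2.
Proof. by rewrite sqr_sqrtr// sumr_ge0// => i _; rewrite sqr_ge0. Qed.

Lemma norm_le_moment_weight (R : realType) (n : nat) (x : 'cV[R]_n) :
  `|x| <= moment_weight x.
Proof.
apply: norm_mx_le => [|i j].
  exact: le_trans (moment_weight_ge1 x).
rewrite ord1 /moment_weight enorm_sqrE (bigD1 i)//=.
have s0 : 0 <= \sum_(k < n | k != i) x k 0 ^+ 2.
  by apply: sumr_ge0 => k _; rewrite sqr_ge0.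
rewrite -(real_normK (num_real (x i 0))).
(* |t| <= 1 + t^2 follows from (|t| - 1)^2 >= 0. *)
have := sqr_ge0 (`|x i 0| - 1).
by have := normr_ge0 (x i 0); nra.
Qed.

Lemma integrable_moment_weight (R : realType) (n : nat)
    (P : probability (borelV R n) R) :
  ('E_P[fun x => (enorm x ^+ 2)%R] < +oo)%E ->
  P.-integrable [set: borelV R n] (EFin \o @moment_weight R n).
Proof.
move=> Poo; have -> : EFin \o @moment_weight R n =
    ((EFin \o cst 1%R) \+ (EFin \o (fun x => enorm x ^+ 2)%R))%E.
  exact/funext.
apply: integrableD => //.
  exact: finite_measure_integrable_cst.
apply/integrableP; split.
  apply/measurable_EFinP; under eq_fun do rewrite enorm_sqrE.
  apply: measurable_sum => i; apply: measurable_funX.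
  by apply: continuous_measurable_borelV; exact: coord_continuous.
move: Poo; rewrite unlock; congr (_ < _)%E.
by apply: eq_integral => x _; rewrite /= ger0_norm// sqr_ge0.
Qed.

(** * Regularity of the piecewise affine loss *)

Lemma bigmax_dist_le (R : realType) (I : Type) (s : seq I) (f g : I -> R)
    (x y c : R) :
  `|x - y| <= c -> (forall i, `|f i - g i| <= c) ->
  `|\big[Num.max/x]_(i <- s) f i - \big[Num.max/y]_(i <- s) g i| <= c.
Proof.
move=> xyc fgc.
apply: (big_ind2 (fun u v => `|u - v| <= c)) => // x1 x2 y1 y2.
rewrite !ler_distl.
move=> /andP[? ?] /andP[? ?].
by case: (leP x1 y1) => ?; case: (leP x2 y2) => ?; apply/andP; split; lra.
Qed.

Section pwa.
Context (R : realType) (Dx Dxi J : nat).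
Variables (A : 'I_J.+1 -> 'M[R]_(Dxi, Dx)) (abar : 'I_J.+1 -> 'cV[R]_Dxi)
  (b : 'I_J.+1 -> 'cV[R]_Dx) (bbar : 'I_J.+1 -> R).

Lemma measurable_pwa_loss (z : 'cV[R]_Dx) :
  measurable_fun [set: borelV R Dxi] (pwa_loss A abar b bbar z).
Proof.
have mpiece j :
    measurable_fun [set: borelV R Dxi] (pwa_piece A abar b bbar z ^~ j).
  apply: measurable_funD; last exact: measurable_cst.
  under eq_fun do rewrite mxE.
  apply: measurable_sum => i; apply: measurable_funM.
    exact: measurable_cst.
  by apply: continuous_measurable_borelV; exact: coord_continuous.
rewrite /pwa_loss; elim: (index_enum _) => [|j s IHs].
  by under eq_fun do rewrite big_nil; exact: mpiece.
by under eq_fun do rewrite big_cons; exact: measurable_maxr.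
Qed.

Lemma pwa_loss_growth (z : 'cV[R]_Dx) :
  exists C : R, forall xi,
    `|pwa_loss A abar b bbar z xi| <= C * moment_weight xi.
Proof.
pose C j := Dxi%:R * `|A j *m z + abar j| + `|((b j)^T *m z) 0 0 + bbar j|.
have C0 j : 0 <= C j by rewrite addr_ge0// mulr_ge0.
exists (\sum_j C j) => xi.
have w1 := moment_weight_ge1 xi.
have piece_le j : `|pwa_piece A abar b bbar z xi j| <=
    (\sum_j C j) * moment_weight xi.
  apply: (@le_trans _ _ (C j * moment_weight xi)).
    rewrite (le_trans (ler_normD _ _))// mulrDl lerD//.
      rewrite (le_trans (norm_dot_le _ _))// ler_wpM2l ?mulr_ge0//.
      exact: norm_le_moment_weight.
    exact: ler_peMr.
  rewrite ler_wpM2r ?(le_trans _ w1)// (bigD1 j)//= lerDl.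
  exact: sumr_ge0.
apply: (big_ind (fun y => `|y| <= _)) => [|x y xC yC|j _] //.
by rewrite /Num.max; case: ifP.
Qed.

(** The difference of the j-th pieces at z and z' is affine in xi with
    coefficients linear in z - z', and a maximum of finitely many terms moves
    no more than its terms. The Lipschitz constant is uniform in z because the
    pieces are affine in z. *)
Lemma pwa_loss_lipschitz : exists L : R, forall z z' xi,
  `|pwa_loss A abar b bbar z xi - pwa_loss A abar b bbar z' xi| <=
  L * `|z - z'| * moment_weight xi.
Proof.
pose L j := Dxi%:R * Dx%:R * `|A j| + Dx%:R * `|b j|.
have L0 j : 0 <= L j by rewrite addr_ge0// !mulr_ge0.
exists (\sum_j L j) => z z' xi.
have w1 := moment_weight_ge1 xi.
have w0 : 0 <= moment_weight xi by exact: le_trans w1.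
suff piece_le j :
    `|pwa_piece A abar b bbar z xi j - pwa_piece A abar b bbar z' xi j| <=
    (\sum_j L j) * `|z - z'| * moment_weight xi.
  exact: bigmax_dist_le.
apply: (@le_trans _ _ (L j * `|z - z'| * moment_weight xi)); last first.
  rewrite ler_wpM2r// ler_wpM2r// (bigD1 j)//= lerDl.
  exact: sumr_ge0.
have -> : pwa_piece A abar b bbar z xi j - pwa_piece A abar b bbar z' xi j =
    ((A j *m (z - z'))^T *m xi) 0 0 + ((b j)^T *m (z - z')) 0 0.
  have -> : A j *m (z - z') = (A j *m z + abar j) - (A j *m z' + abar j).
    by rewrite mulmxBr opprD addrACA subrr addr0.
  have sub00 (M N : 'M[R]_1) : (M - N) 0 0 = M 0 0 - N 0 0 by rewrite !mxE.
  rewrite /pwa_piece mulmxBr linearB/= mulmxBl !sub00; ring.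
rewrite (le_trans (ler_normD _ _))// !mulrDl lerD//.
  apply: le_trans (norm_dot_le _ _) _.
  apply: ler_pM; rewrite ?mulr_ge0// ?norm_le_moment_weight//.
  by rewrite -!mulrA ler_wpM2l// !mulrA norm_mulmx_le.
apply: le_trans (norm_dot_le _ _) _.
by rewrite ler_peMr// !mulr_ge0.
Qed.

(** * The expected loss as a function of the decision *)

Section expected_loss.
Variable P : probability (borelV R Dxi) R.
Hypothesis Poo : ('E_P[fun x => (enorm x ^+ 2)%R] < +oo)%E.

Lemma integrable_pwa_loss (z : 'cV[R]_Dx) :
  P.-integrable [set: borelV R Dxi] (EFin \o pwa_loss A abar b bbar z).
Proof.
have [C ellC] := pwa_loss_growth z.
apply: (le_integrable _ _ _
  (integrableZl _ C (integrable_moment_weight Poo))) => //.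
  by apply/measurable_EFinP; exact: measurable_pwa_loss.
by move=> xi _ /=; rewrite lee_fin (le_trans (ellC xi)) ?ler_norm.
Qed.

Lemma expectation_pwa_lossE (z : 'cV[R]_Dx) :
  'E_P[pwa_loss A abar b bbar z]%E =
  (\int[P]_xi pwa_loss A abar b bbar z xi)%:E.
Proof.
by rewrite unlock /Rintegral fineK// integrable_fin_num//;
  exact: integrable_pwa_loss.
Qed.

(** The pointwise Lipschitz bound integrates to the Lipschitz constant
    L * E_P[w], which is finite by the moment assumption. *)
Lemma continuous_expected_pwa_loss :
  continuous (fun z => \int[P]_xi pwa_loss A abar b bbar z xi).
Proof.
have [L ellL] := pwa_loss_lipschitz.
have iw := integrable_moment_weight Poo.
apply: (@lipschitz_continuous _ _ _
  (L * \int[P]_xi moment_weight xi)) => z z'.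
have iB : P.-integrable [set: borelV R Dxi] (EFin \o
    (fun xi => pwa_loss A abar b bbar z xi - pwa_loss A abar b bbar z' xi)).
  exact: (integrableB _ (integrable_pwa_loss z) (integrable_pwa_loss z')).
rewrite -RintegralB//; [|exact: integrable_pwa_loss..].
rewrite mulrAC -RintegralZl//.
apply: (le_trans (le_normr_Rintegral _ iB)) => //.
apply: le_Rintegral => //.
- exact: integrable_norm.
- exact: (integrableZl measurableT (L * `|z - z'|) iw).
Qed.

End expected_loss.
End pwa.

Unset Implicit Arguments.

Theorem proposition1 (R : realType) (Dx Dxi J : nat)
    (X : set 'cV[R]_Dx) (Xi : set 'cV[R]_Dxi)
    (A : 'I_J.+1 -> 'M[R]_(Dxi, Dx)) (abar : 'I_J.+1 -> 'cV[R]_Dxi)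
    (b : 'I_J.+1 -> 'cV[R]_Dx) (bbar : 'I_J.+1 -> R)
    (c1 c2 eps Omega : R)
    (Pstar PN : probability (borelV R Dxi) R)
    (Z : probability (borelV R Dx) R)
    (X_compact : compact X)
    (X_convex : convex_set (X : set (convex_lmodType 'cV[R]_Dx)))
    (c1_ge0 : 0 <= c1) (c2_ge0 : 0 <= c2)
    (loss_bound : forall x xi, X x -> Xi xi ->
      `|pwa_loss A abar b bbar x xi| <= c1 + c2 * enorm xi)
    (Pstar_Xi : dist_on Xi Pstar) (PN_Xi : dist_on Xi PN)
    (PN_moment : ('E_PN[fun xi => (enorm xi ^+ 2)%R] < Omega%:E)%E)
    (Pstar_moment : ('E_Pstar[fun xi => (enorm xi ^+ 2)%R] <= Omega%:E)%E)
    (eps_ge0 : 0 <= eps)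
    (Z_X : dist_on X Z) (Z_full_support : dist_support Z = X) :
  ambiguity_set Xi (pwa_loss A abar b bbar) Z PN eps Omega =
  inf_ambiguity_set X Xi (pwa_loss A abar b bbar) PN eps Omega.
Proof.
set ell := pwa_loss A abar b bbar.
have PNoo : ('E_PN[fun xi => (enorm xi ^+ 2)%R] < +oo)%E.
  by apply: lt_trans PN_moment _; exact: ltry.
pose g (Q : probability (borelV R Dxi) R) z :=
  \int[Q]_xi ell z xi - \int[PN]_xi ell z xi - eps.
have gE (Q : probability (borelV R Dxi) R) z :
    ('E_Q[fun xi => (enorm xi ^+ 2)%R] <= Omega%:E)%E ->
    ('E_Q[ell z] - 'E_PN[ell z] - eps%:E)%E = (g Q z)%:E.
  move=> QOmega; rewrite !expectation_pwa_lossE//.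
  exact: le_lt_trans QOmega (ltry _).
(* Both sets impose the moment bound, and under it the two remaining conditions
   are about the same continuous function g Q. *)
have main (Q : probability (borelV R Dxi) R) :
    ('E_Q[fun xi => (enorm xi ^+ 2)%R] <= Omega%:E)%E ->
    (\int[Z]_z maxe ('E_Q[ell z] - 'E_PN[ell z] - eps%:E) 0 <= 0)%E <->
    (forall z, X z -> ('E_Q[ell z] - 'E_PN[ell z] <= eps%:E)%E).
  move=> QOmega.
  have -> : (\int[Z]_z maxe ('E_Q[ell z] - 'E_PN[ell z] - eps%:E) 0 =
      \int[Z]_z (Num.max (g Q z) 0)%:E)%E.
    by apply: eq_integral => z _; rewrite gE// EFin_max.
  have cg : continuous (g Q).
    have Qoo := le_lt_trans QOmega (ltry _).
    have cm (P : probability (borelV R Dxi) R) :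
        ('E_P[fun xi => (enorm xi ^+ 2)%R] < +oo)%E ->
        continuous (fun z => \int[P]_xi ell z xi).
      by move=> Poo; exact: continuous_expected_pwa_loss.
    by move=> z; exact: cvgB (cvgB (cm Q Qoo z) (cm PN PNoo z)) (cvg_cst eps).
  rewrite (integral_pos_part_le0P Z_X Z_full_support cg).
  have leE z : ('E_Q[ell z] - 'E_PN[ell z] <= eps%:E)%E = (g Q z <= 0).
    by rewrite -sube_le0 gE.
  by split=> h z Xz; move: (h z Xz); rewrite leE.
by apply/seteqP; split=> Q [QXi QZ QOmega]; split=> //; apply/(main Q QOmega).
Qed.
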